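(* Consider the discrete-time LTI feedback system $$\mathbf{y} = \mathbf{G}\mathbf{u} + \mathbf{v}, \qquad \mathbf{u} = \mathbf{K}\mathbf{y} + \mathbf{r},$$ with plant $\mathbf{G}\in\mathcal{R}_c^{p\times m}$ and controller $\mathbf{K}\in\mathcal{R}_c^{m\times p}$. For a given $\mathbf{K}$, consider the following affine constraints on a quadruple $(\mathbf{W},\mathbf{X},\mathbf{Y},\mathbf{Z})$ of transfer matrices of sizes $p\times p$, $p\times m$, $m\times p$, $m\times m$ respectively: $$\text{(a)}\quad \begin{bmatrix} -\mathbf{K} & I\end{bmatrix}\begin{bmatrix}\mathbf{W} & \mathbf{X}\\ \mathbf{Y} & \mathbf{Z}\end{bmatrix} = \begin{bmatrix} 0 & I\end{bmatrix},$$ $$\text{(b)}\quad \begin{bmatrix}\mathbf{W} & \mathbf{X}\\ \mathbf{Y} & \mathbf{Z}\end{bmatrix}\begin{bmatrix} I\\ -\mathbf{K}\end{bmatrix} = \begin{bmatrix} I\\ 0\end{bmatrix},$$ $$\text{(c)}\quad \mathbf{W},\mathbf{X},\mathbf{Y},\mathbf{Z}\in\mathcal{RH}_\infty.$$ Then the following statements are true. 1. Suppose a controller $\mathbf{K}$ is given and stabilizes the unknown plant $\mathbf{G}$. Then there always exist $(\mathbf{W},\mathbf{X},\mathbf{Y},\mathbf{Z})$ that satisfy (a), (b) and (c). 2. For any transfer matrices $(\mathbf{W},\mathbf{X},\mathbf{Y},\mathbf{Z})$ that satisfy (a), (b) and (c), the parameterized plant $$\mathbf{G} = \mathbf{W}^{-1}\mathbf{X}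 = \mathbf{X}\mathbf{Z}^{-1}$$ belongs to $\mathcal{G}_{\mathrm{stab}}(\mathbf{K})$, the set of all plants stabilized by $\mathbf{K}$.
   Context: All systems are discrete-time, linear and time-invariant, and are described by transfer matrices in the variable $z$. $\mathcal{R}_c$ denotes the space of all causal (proper) transfer functions and $\mathcal{RH}_\infty$ the space of all bounded, stable and causal transfer functions; $\mathcal{R}_c^{p\times m}$ and $\mathcal{RH}_\infty^{p\times m}$ are the spaces of $p\times m$ matrices with entries in them (sizes are omitted when clear). $I$ and $0$ are identity and zero matrices of appropriate sizes. The signals are the output $\mathbf{y}$ (dimension $p$), the control input $\mathbf{u}$ (dimension $m$), the reference $\mathbf{r}$ (dimension $m$) and the output disturbance $\mathbf{v}$ (dimension $p$). The feedback is positive. Neither $\mathbf{G}$ nor $\mathbf{K}$ is assumed to be stable by itself. The closed-loop map from the external signals $(\mathbf{v},\mathbf{r})$ to $(\mathbf{y},\mathbf{u})$ is $$\begin{bmatrix}\mathbf{y}\\ \mathbf{u}\end{bmatrix} = \begin{bmatrix}(I-\mathbf{G}\mathbf{K})^{-1} & (I-\mathbf{G}\mathbf{K})^{-1}\mathbf{G}\\ (I-\mathbf{K}\mathbf{G})^{-1}\mathbf{K} & (I-\mathbf{K}\mathbf{G})^{-1}\end{bmatrix}\begin{bmatrix}\mathbf{v}\\ \mathbf{r}\end{bmatrix}.$$ ''$\mathbf{K}$ stabilizes $\mathbf{G}$'' (equivalently, ''$\mathbf{G}$ is stabilized by $\mathbf{K}$'') means internal stability of this feedback interconnection: the four closed-loop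 transfer matrices above are well defined and belong to $\mathcal{RH}_\infty$. The set of plants stabilized by $\mathbf{K}$ is $\mathcal{G}_{\mathrm{stab}}(\mathbf{K}) = \{\mathbf{G}\in\mathcal{R}_c^{p\times m} : \mathbf{G}\text{ is stabilized by }\mathbf{K}\}$.
   Formalization: In part 2, W is additionally assumed invertible with causal (proper) inverse; otherwise K=1, X=-1, W=Y=Z=0 leaves G undefined, and K=1, W=Y=Z=1/z, X=1/z-1 gives the non-causal G=1-z. Transfer functions are real-rational. *)

(* Defs.v *)
From HB Require Import structures.
From mathcomp Require Import all_boot all_order all_algebra.
From mathcomp Require Import classical_sets reals.
From mathcomp Require Import complex.

Set Implicit Arguments.
Unset Strict Implicit.
Unset Printing Implicit Defensive.

Import Order.TTheory GRing.Theory Num.Theory.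
Local Open Scope ring_scope.
Local Open Scope complex_scope.
Local Open Scope classical_set_scope.

(* Transfer functions are real-rational functions of z, i.e. elements of R(z);
   the polynomial indeterminate 'X is the variable z. *)
Notation transfer R := {fraction {poly R}}.

Section TransferFunctions.
Variable R : realType.
Implicit Types (f : transfer R) (n d : {poly R}) (z : R[i]).

Definition is_frac f n d : Prop := d != 0 /\ f = tofrac n / tofrac d.

Definition evalC n z : R[i] := (map_poly (real_complex R) n).[z].

(* Proper: the degree of the numerator is at most that of the denominator. *)
Definition causal f : Prop :=
  exists n d, is_frac f n d /\ (size n <= size d)%N.

(* Poles are the complex zeros of the denominator in lowest terms. *)
Definition pole f z : Prop :=
  exists n d, [/\ is_frac f n d, coprimep n d & evalC d z = 0].

Definition stable f : Prop := forall z, pole f z -> `|z| < 1.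

(* |f| <= M on |z| >= 1, cross-multiplied so as not to divide by zero. *)
Definition bounded_outside_disk f : Prop :=
  exists M : R, forall z n d, 1 <= `|z| -> is_frac f n d ->
    `|evalC n z| <= M%:C * `|evalC d z|.

Definition Rc : set (transfer R) := [set f | causal f].

(* For rational functions the three conditions overlap: a proper stable
   function is automatically bounded outside the disk. *)
Definition RHinf : set (transfer R) :=
  [set f | [/\ bounded_outside_disk f, stable f & causal f]].

Definition mx_in (S : set (transfer R)) (p m : nat)
    (A : 'M[transfer R]_(p, m)) : Prop :=
  forall i j, S (A i j).

(* The map (v, r) |-> (y, u) of the positive feedback interconnection
   y = G u + v, u = K y + r; meaningful when both inverses exist. *)
Definition closed_loop (p m : nat) (K : 'M[transfer R]_(m, p))
    (G : 'M[transfer R]_(p, m)) : 'M[transfer R]_(p + m, p + m) :=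
  block_mx (invmx (1%:M - G *m K)) (invmx (1%:M - G *m K) *m G)
           (invmx (1%:M - K *m G) *m K) (invmx (1%:M - K *m G)).

(* invmx is the identity on singular matrices, hence the unitmx conditions. *)
Definition stabilizes (p m : nat) (K : 'M[transfer R]_(m, p))
    (G : 'M[transfer R]_(p, m)) : Prop :=
  [/\ 1%:M - G *m K \in unitmx, 1%:M - K *m G \in unitmx &
      mx_in RHinf (closed_loop K G)].

Definition Gstab (p m : nat) (K : 'M[transfer R]_(m, p)) :
    set 'M[transfer R]_(p, m) :=
  [set G | mx_in Rc G /\ stabilizes K G].

Definition affine_constraints (p m : nat) (K : 'M[transfer R]_(m, p))
    (W : 'M[transfer R]_(p, p)) (X : 'M[transfer R]_(p, m))
    (Y : 'M[transfer R]_(m, p)) (Z : 'M[transfer R]_(m, m)) : Prop :=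
  [/\ row_mx (- K) 1%:M *m block_mx W X Y Z = row_mx 0 1%:M,
      block_mx W X Y Z *m col_mx 1%:M (- K) = col_mx 1%:M 0 &
      [/\ mx_in RHinf W, mx_in RHinf X, mx_in RHinf Y & mx_in RHinf Z]].

End TransferFunctions.

(* Main.v *)
(* Multiplied out, the affine constraints say W = I + XK, Z = I + KX and
   Y = KW = ZK.  If K stabilizes G, the closed-loop blocks satisfy them by the
   push-through identity K(I - GK)^-1 = (I - KG)^-1 K.  Conversely, for
   G = W^-1 X one finds I - GK = W^-1 and I - KG = Z^-1, so the closed-loop map
   is the given block matrix; G is causal as a product of causal matrices. *)

Require Import Defs.
From HB Require Import structures.
From mathcomp Require Import all_boot all_order all_algebra.
From mathcomp Require Import classical_sets reals.
Set Implicit Arguments.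
Unset Strict Implicit.
Unset Printing Implicit Defensive.
Import Order.TTheory GRing.Theory Num.Theory.
Local Open Scope ring_scope.

Section Causal.
Variable R : realType.
Implicit Types f g : transfer R.

Lemma causal0 : causal (0 : transfer R).
Proof.
exists 0, 1; split; last by rewrite size_poly0.
by split; rewrite ?oner_neq0 // tofrac0 mul0r.
Qed.

Lemma causalM f g : causal f -> causal g -> causal (f * g).
Proof.
move=> [n1 [d1 [[d1N0 ->] le1]]] [n2 [d2 [[d2N0 ->] le2]]].
exists (n1 * n2), (d1 * d2); split.
  by split; rewrite ?mulf_neq0 // !tofracM mulf_div.
(* Nonzero denominators give their product an exact size; a numerator may vanish, so for it only the
   upper bound holds, with the same [.-1]. *)
rewrite (size_mul d1N0 d2N0); apply: leq_trans (size_polyMleq _ _) _.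
by rewrite -!subn1 leq_sub2r ?leq_add.
Qed.

Lemma causalD f g : causal f -> causal g -> causal (f + g).
Proof.
move=> [n1 [d1 [[d1N0 ->] le1]]] [n2 [d2 [[d2N0 ->] le2]]].
exists (n1 * d2 + n2 * d1), (d1 * d2); split.
  by split; rewrite ?mulf_neq0 // tofracD !tofracM addf_div ?tofrac_eq0.
rewrite (size_mul d1N0 d2N0); apply: leq_trans (size_polyD _ _) _.
rewrite geq_max; apply/andP; split; apply: leq_trans (size_polyMleq _ _) _.
  by rewrite -!subn1 leq_sub2r ?leq_add.
by rewrite addnC -!subn1 leq_sub2r ?leq_add.
Qed.

Lemma causal_mulmx m n p (A : 'M[transfer R]_(m, n)) (B : 'M_(n, p)) :
  mx_in (@Rc R) A -> mx_in (@Rc R) B -> mx_in (@Rc R) (A *m B).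
Proof.
move=> cA cB i j; rewrite mxE.
elim/big_ind: _ => [|f g|k _]; [exact: causal0 | exact: causalD |].
exact: causalM (cA i k) (cB k j).
Qed.

End Causal.

Section MatrixBlocks.
Variables (F : fieldType) (p m : nat).
Implicit Types (G X : 'M[F]_(p, m)) (K Y : 'M[F]_(m, p)).

(** Clearing both inverses leaves (I - KG)K = K(I - GK), where both sides expand to K - KGK. *)
Lemma push_through G K :
  1%:M - G *m K \in unitmx -> 1%:M - K *m G \in unitmx ->
  K *m invmx (1%:M - G *m K) = invmx (1%:M - K *m G) *m K.
Proof.
move=> uGK uKG; apply: (can_inj (mulKmx uKG)).
apply: (can_inj (mulmxK uGK)).
rewrite mulKVmx // mulmxA mulmxKV //.
by rewrite mulmxBl mulmxBr mul1mx mulmx1 mulmxA.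
Qed.

Lemma affine_eqsP K (W : 'M_p) X Y (Z : 'M_m) :
  row_mx (- K) 1%:M *m block_mx W X Y Z = row_mx 0 1%:M /\
  block_mx W X Y Z *m col_mx 1%:M (- K) = col_mx 1%:M 0 <->
  [/\ Y = K *m W, Z = 1%:M + K *m X, W = 1%:M + X *m K & Y = Z *m K].
Proof.
rewrite mul_row_block mul_block_col !mul1mx !mulmx1 !mulNmx !mulmxN.
split=> [[/eq_row_mx [a1 a2] /eq_col_mx [b1 b2]] | [a1 a2 b1 b2]].
  split; first by apply/eqP; rewrite -subr_eq0 addrC a1.
  - by rewrite -a2 addrAC addNr add0r.
  - by rewrite -b1 subrK.
  - by apply/eqP; rewrite -subr_eq0 b2.
split.
  by rewrite a1 addNr a2 addrC addrK.
by rewrite b2 subrr b1 addrK.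
Qed.

Lemma closed_loop_affine_eqs G K
    (U := invmx (1%:M - G *m K)) (V := invmx (1%:M - K *m G)) :
  1%:M - G *m K \in unitmx -> 1%:M - K *m G \in unitmx ->
  row_mx (- K) 1%:M *m block_mx U (U *m G) (V *m K) V = row_mx 0 1%:M /\
  block_mx U (U *m G) (V *m K) V *m col_mx 1%:M (- K) = col_mx 1%:M 0.
Proof.
move=> uGK uKG; apply/affine_eqsP; split=> //.
- by rewrite push_through.
(* Expanding V(I - KG) = I gives V = I + VKG, and VK = KU turns this into Z = I + KX. *)
- have VV : V *m (1%:M - K *m G) = 1%:M by rewrite mulVmx.
  by rewrite mulmxA push_through // -/V -VV mulmxBr mulmx1 mulmxA subrK.
- have UU : U *m (1%:M - G *m K) = 1%:M by rewrite mulVmx.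
  by rewrite -UU mulmxBr mulmx1 mulmxA subrK.
Qed.

(** For square matrices a one-sided inverse is two-sided, so one product yields both invertibility
    and the value of the inverse. *)
Lemma unitmx_invl n (A B : 'M[F]_n) : A *m B = 1%:M ->
  A \in unitmx /\ invmx A = B.
Proof.
move=> AB; have [uA _] := mulmx1_unit AB; split=> //.
by rewrite -[RHS](mulKmx uA) AB mulmx1.
Qed.

Lemma affine_eqs_closed_loop K (W : 'M_p) X Y (Z : 'M_m)
    (G := invmx W *m X) :
  row_mx (- K) 1%:M *m block_mx W X Y Z = row_mx 0 1%:M ->
  block_mx W X Y Z *m col_mx 1%:M (- K) = col_mx 1%:M 0 ->
  W \in unitmx ->
  [/\ 1%:M - G *m K \in unitmx, 1%:M - K *m G \in unitmx, Z \in unitmx,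
      G = X *m invmx Z &
      block_mx (invmx (1%:M - G *m K)) (invmx (1%:M - G *m K) *m G)
               (invmx (1%:M - K *m G) *m K) (invmx (1%:M - K *m G))
      = block_mx W X Y Z].
Proof.
move=> eq_a eq_b uW.
have [eY eZ eW eY'] := (affine_eqsP K W X Y Z).1 (conj eq_a eq_b).
have GZ : G *m Z = X.
  (* Both products equal X + XKX; this is what makes the two formulas for G agree. *)
  have WX : W *m X = X *m Z.
    by rewrite eW eZ mulmxDl mulmxDr mul1mx mulmx1 mulmxA.
  by rewrite -mulmxA -WX mulKmx.
(* Trading KW for ZK brings G next to Z: GKW = GZK = XK, and W - XK = I. *)
have IGK : (1%:M - G *m K) *m W = 1%:M.
  rewrite mulmxBl mul1mx -mulmxA -eY eY' mulmxA GZ.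
  by rewrite {1}eW addrK.
have IKG : (1%:M - K *m G) *m Z = 1%:M.
  by rewrite mulmxBl mul1mx -mulmxA GZ eZ addrK.
have [uGK iGK] := unitmx_invl IGK; have [uKG iKG] := unitmx_invl IKG.
(* Invertibility of Z is thus a consequence of that of W. *)
have [_ uZ] := mulmx1_unit IKG.
split=> //; first by rewrite -GZ mulmxK.
by rewrite iGK iKG mulKVmx // -eY'.
Qed.

End MatrixBlocks.

Lemma mx_in_block (R : realType) (S : classical_sets.set (transfer R)) p m
    (W : 'M_p) (X : 'M_(p, m)) (Y : 'M_(m, p)) (Z : 'M_m) :
  mx_in S (block_mx W X Y Z) <->
  [/\ mx_in S W, mx_in S X, mx_in S Y & mx_in S Z].
Proof.
split=> [sM | [sW sX sY sZ] i j].
  split=> i j.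
  - by rewrite -(block_mxEul W X Y Z).
  - by rewrite -(block_mxEur W X Y Z).
  - by rewrite -(block_mxEdl W X Y Z).
  - by rewrite -(block_mxEdr W X Y Z).
(* Writing each index as the [unsplit] of its [split] shows which block the entry lies in. *)
rewrite -(splitK i) -(splitK j).
case: (split i) => i'; case: (split j) => j' /=.
- by rewrite block_mxEul.
- by rewrite block_mxEur.
- by rewrite block_mxEdl.
- by rewrite block_mxEdr.
Qed.

Theorem theorem2 (R : realType) (p m : nat) (K : 'M[transfer R]_(m, p))
    (K_causal : mx_in (@Rc R) K) :
  (forall G : 'M[transfer R]_(p, m), mx_in (@Rc R) G -> stabilizes K G ->
     exists (W : 'M[transfer R]_(p, p)) (X : 'M[transfer R]_(p, m))
            (Y : 'M[transfer R]_(m, p)) (Z : 'M[transfer R]_(m, m)),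
       affine_constraints K W X Y Z)
  /\
  (forall (W : 'M[transfer R]_(p, p)) (X : 'M[transfer R]_(p, m))
          (Y : 'M[transfer R]_(m, p)) (Z : 'M[transfer R]_(m, m)),
     affine_constraints K W X Y Z ->
     (* the inverse of W exists *)
     W \in unitmx ->
     [/\ Z \in unitmx,
         invmx W *m X = X *m invmx Z &
         (* the inverse of W is moreover causal *)
         (mx_in (@Rc R) (invmx W) -> Gstab K (invmx W *m X))]).
Proof.
split=> [G _ [uGK uKG cl] | W X Y Z [eq_a eq_b sM] uW].
  have [eq_a eq_b] := closed_loop_affine_eqs uGK uKG.
  exists (invmx (1%:M - G *m K)), (invmx (1%:M - G *m K) *m G),
    (invmx (1%:M - K *m G) *m K), (invmx (1%:M - K *m G)).
  by split; [exact: eq_a | exact: eq_b | exact/mx_in_block].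
have [uGK uKG uZ GE cl] := affine_eqs_closed_loop eq_a eq_b uW.
split; [exact: uZ | exact: GE | move=> cVW; split; last split].
(* Invertibility over R(z) would not suffice here: for K = 1, W = Y = Z = 1/z and X = 1/z - 1 meet
   the constraints, yet G = 1 - z is improper. *)
- apply: (causal_mulmx cVW) => i j.
  by case: sM => _ sX _ _; case: (sX i j).
- exact: uGK.
- exact: uKG.
- by rewrite /closed_loop cl; apply/mx_in_block.
Qed.
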